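(* Let $d\ge2$, let $\{g_k\mid k=1,\dots,d^2-1\}$ be traceless (Hermitian) $SU(d)$ generators on $\mathbb{C}^d$ with $\operatorname{Tr}(g_kg_l)=2\delta_{kl}$, and let $G_k=g_k\otimes I+I\otimes g_k$ on $\mathbb{C}^d\otimes\mathbb{C}^d$. Let $\rho$ be a state on $\mathbb{C}^d\otimes\mathbb{C}^d$, write $\langle G_k\rangle=\operatorname{Tr}(G_k\rho)$, and set $$W_2=\sum_{k=1}^{d^2-1}\bigl(G_k-\langle G_k\rangle I\bigr)^2-(4d-4)I.$$ Then $$D_{sep}(\rho)\ge-\frac{\operatorname{Tr}(W_2\rho)}{\sqrt{144d^2-224d+112}}.$$
   Context: A state is a positive semidefinite operator of trace one. A state $\sigma$ on $\mathbb{C}^d\otimes\mathbb{C}^d$ is separable if $\sigma=\sum_i p_i\,\rho_A^i\otimes\rho_B^i$ for a (finite) probability distribution $\{p_i\}$ and states $\rho_A^i,\rho_B^i$ on $\mathbb{C}^d$; $Sep(A:B)$ is the set of separable states. $\|A\|_F=\sqrt{\operatorname{Tr}(A^\dagger A)}$ is the Frobenius norm, and $D_{sep}(\rho)=\min_{\sigma\in Sep(A:B)}\|\rho-\sigma\|_F$. $I$ denotes the identity operator on the relevant space. *)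

(* Defs.v *)
From mathcomp Require Import all_boot all_order all_algebra.
From mathcomp Require Import sesquilinear spectral.
From mathcomp Require Import boolp classical_sets reals.
From mathcomp.real_closed Require Export complex mxtens.

Set Implicit Arguments.
Unset Strict Implicit.
Unset Printing Implicit Defensive.

Import Order.TTheory GRing.Theory Num.Theory.
Local Open Scope ring_scope.
Local Open Scope complex_scope.
Local Open Scope sesquilinear_scope.
Local Open Scope classical_set_scope.

(** Operators on C^d are matrices over [R[i]].  The space C^d (x) C^d is
    identified with C^(d * d) through the lexicographic product basis, for which
    the tensor product of operators is the Kronecker product [A *t B]. *)

(* The order of [R[i]] satisfies [0 <= z] iff z is real and nonnegative. *)
Definition is_psd (R : realType) (n : nat) (A : 'M[R[i]]_n) : Prop :=
  A \is hermsymmx /\ forall v : 'cV[R[i]]_n, 0 <= (v ^t* *m A *m v) 0 0.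

Definition is_state (R : realType) (n : nat) (rho : 'M[R[i]]_n) : Prop :=
  is_psd rho /\ \tr rho = 1.

Definition Sep (R : realType) (d : nat) : set 'M[R[i]]_(d * d) :=
  [set sigma | exists (m : nat) (p : 'I_m -> R) (rhoA rhoB : 'I_m -> 'M[R[i]]_d),
    [/\ forall i, 0 <= p i,
        \sum_i p i = 1,
        forall i, is_state (rhoA i),
        forall i, is_state (rhoB i)
      & sigma = \sum_i (p i)%:C *: (rhoA i *t rhoB i)]].

(* [Tr (A^dagger A)] is real and nonnegative, so [Re] only changes its type. *)
Definition frobenius (R : realType) (m n : nat) (A : 'M[R[i]]_(m, n)) : R :=
  Num.sqrt (complex.Re (\tr (A ^t* *m A))).

(* The minimum is taken as an infimum in R; see [has_inf_sep_dist]. *)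
Definition Dsep (R : realType) (d : nat) (rho : 'M[R[i]]_(d * d)) : R :=
  inf [set frobenius (rho - sigma) | sigma in @Sep R d].

Definition su_generators (R : realType) (d : nat)
    (g : 'I_(d ^ 2 - 1)%N -> 'M[R[i]]_d) : Prop :=
  [/\ forall k, g k \is hermsymmx,
      forall k, \tr (g k) = 0
    & forall k l, \tr (g k *m g l) = 2 * (k == l)%:R].

Definition collective (R : realType) (d : nat) (A : 'M[R[i]]_d) :
    'M[R[i]]_(d * d) :=
  A *t 1%:M + 1%:M *t A.

Definition expectation (R : realType) (n : nat) (rho A : 'M[R[i]]_n) : R[i] :=
  \tr (A *m rho).

Definition W2 (R : realType) (d : nat) (g : 'I_(d ^ 2 - 1)%N -> 'M[R[i]]_d)
    (rho : 'M[R[i]]_(d * d)) : 'M[R[i]]_(d * d) :=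
  \sum_k (collective (g k) - (expectation rho (collective (g k)))%:M) ^+ 2
  - (4 * d%:R - 4)%:M.

Lemma maximally_mixed_state (R : realType) (d : nat) :
  (0 < d)%N -> is_state ((d%:R^-1)%:M : 'M[R[i]]_d).
Proof.
move=> d0; split; last first.
  by rewrite mxtrace_scalar -[LHS]mulr_natr mulVf // pnatr_eq0 -lt0n.
have dV : 0 <= d%:R^-1 :> R[i] by rewrite invr_ge0 ler0n.
split.
  apply/is_hermitianmxP; rewrite expr0 scale1r tr_scalar_mx map_scalar_mx /=.
  by congr (_%:M); rewrite geC0_conj.
move=> v; rewrite mul_mx_scalar -scalemxAl mxE mulr_ge0 // mxE.
by apply: sumr_ge0 => j _; rewrite !mxE mulrC mul_conjC_ge0.
Qed.

(* [Dsep] is a genuine infimum, not the default value of [inf]. *)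
Lemma has_inf_sep_dist (R : realType) (d : nat) (rho : 'M[R[i]]_(d * d)) :
  (0 < d)%N -> has_inf [set frobenius (rho - sigma) | sigma in @Sep R d].
Proof.
move=> d0; split; last first.
  by exists 0 => _ [sigma _ <-]; exact: sqrtr_ge0.
pose m := (d%:R^-1)%:M : 'M[R[i]]_d.
have ms : is_state m by exact: maximally_mixed_state.
exists (frobenius (rho - m *t m)), (m *t m) => //.
exists 1%N, (fun=> 1), (fun=> m), (fun=> m).
by split => //; rewrite ?big_ord1 // scale1r.
Qed.

(* Main.v *)
Require Import Defs.
From mathcomp Require Import all_boot all_order all_algebra.
From mathcomp Require Import sesquilinear spectral ring lra.
From mathcomp Require Import reals.
From mathcomp.real_closed Require Import complex mxtens.

(** Write [c_k] for the mean of [G_k] in [rho].  Up to a multiple of the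
    identity, [W2] is [T = 2 (sum_k g_k (x) g_k) - 2 (sum_k c_k G_k)], because
    the Casimir [sum_k g_k ^ 2] is scalar.  By Bessel's inequality and [Tr (a ^ 2) <= 1],
    [W2] has nonnegative mean in product states, hence in separable ones, so
    [- Tr (W2 rho) <= Tr (W2 (sigma - rho)) = Tr (T (sigma - rho))
     <= |T|_F |rho - sigma|_F].  The two parts of [T] are orthogonal and
    [|T|_F ^ 2 = 16 (d ^ 2 - 1) + 16 d (sum_k c_k ^ 2)].  Cauchy-Schwarz between
    [sum_k c_k G_k] and [rho - I / d ^ 2] gives [sum_k c_k ^ 2 <= 4 d - 4 / d];
    what is left is [0 <= (2 d - 3) (d - 2)]. *)

Set Implicit Arguments.
Unset Strict Implicit.
Unset Printing Implicit Defensive.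

Import Order.TTheory GRing.Theory Num.Theory.
Local Open Scope ring_scope.
Local Open Scope complex_scope.
Local Open Scope sesquilinear_scope.

(** * Hermitian matrices, Kronecker products and the real trace form *)

Section TraceForm.
Variable R : realType.
Implicit Types n : nat.

Lemma hermP n (A : 'M[R[i]]_n) : reflect (A^t* = A) (A \is hermsymmx).
Proof.
apply: (iffP idP) => [/is_hermitianmxP|] h.
  by rewrite {2}h expr0 scale1r.
by apply/is_hermitianmxP; rewrite expr0 scale1r h.
Qed.

Lemma herm1 n : (1%:M : 'M[R[i]]_n) \is hermsymmx.
Proof. exact: hermitian1mx_subproof. Qed.

Lemma hermD n (A B : 'M[R[i]]_n) :
  A \is hermsymmx -> B \is hermsymmx -> A + B \is hermsymmx.
Proof.
by move=> /hermP hA /hermP hB; apply/hermP; rewrite linearD /= map_mxD hA hB.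
Qed.

Lemma hermZ n (x : R) (A : 'M[R[i]]_n) :
  A \is hermsymmx -> x%:C *: A \is hermsymmx.
Proof.
move=> /hermP hA; apply/hermP; rewrite linearZ /= map_mxZ hA.
by congr (_ *: _); exact: conjc_real.
Qed.

Lemma hermB n (A B : 'M[R[i]]_n) :
  A \is hermsymmx -> B \is hermsymmx -> A - B \is hermsymmx.
Proof.
by move=> /hermP hA /hermP hB; apply/hermP; rewrite linearB /= map_mxB hA hB.
Qed.

Lemma herm_sum n (I : finType) (F : I -> 'M[R[i]]_n) :
  (forall i, F i \is hermsymmx) -> \sum_i F i \is hermsymmx.
Proof.
move=> h; elim/big_ind: _ => // [|A B]; last exact: hermD.
by apply/hermP; rewrite trmx0 map_mx0.
Qed.

Lemma herm_tens m n (A : 'M[R[i]]_m) (B : 'M[R[i]]_n) :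
  A \is hermsymmx -> B \is hermsymmx -> A *t B \is hermsymmx.
Proof.
by move=> /hermP hA /hermP hB; apply/hermP; rewrite trmx_tens map_mxT hA hB.
Qed.

Lemma tensmx_suml m n p q (I : finType) (F : I -> 'M[R[i]]_(m, n))
    (B : 'M_(p, q)) :
  (\sum_i F i) *t B = \sum_i F i *t B.
Proof.
apply/matrixP => i j; rewrite mxE !summxE mulr_suml.
by apply: eq_bigr => k _; rewrite mxE.
Qed.

Lemma tensmx_sumr m n p q (I : finType) (A : 'M[R[i]]_(m, n))
    (F : I -> 'M_(p, q)) :
  A *t (\sum_i F i) = \sum_i A *t F i.
Proof.
apply/matrixP => i j; rewrite mxE !summxE mulr_sumr.
by apply: eq_bigr => k _; rewrite mxE.
Qed.

Lemma tensmxZl m n p q (x : R[i]) (A : 'M_(m, n)) (B : 'M_(p, q)) :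
  (x *: A) *t B = x *: (A *t B).
Proof. by apply/matrixP => i j; rewrite !mxE mulrA. Qed.

Lemma tensmxZr m n p q (x : R[i]) (A : 'M_(m, n)) (B : 'M_(p, q)) :
  A *t (x *: B) = x *: (A *t B).
Proof. by apply/matrixP => i j; rewrite !mxE mulrCA. Qed.

Lemma tensmx11 m n : 1%:M *t 1%:M = 1%:M :> 'M[R[i]]_(m * n).
Proof.
apply/matrixP => i j; case: (mxtens_indexP i) => i1 i2.
case: (mxtens_indexP j) => j1 j2; rewrite tensmxE !mxE -natrM mulnb.
by rewrite (inj_eq (can_inj (@mxtens_indexK _ _))) xpair_eqE.
Qed.

Lemma mxtrace_tens m n (A : 'M[R[i]]_m) (B : 'M[R[i]]_n) :
  \tr (A *t B) = \tr A * \tr B.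
Proof.
rewrite /mxtrace mulr_sum; apply: eq_bigr => i _.
by rewrite mxE.
Qed.

(** On Hermitian matrices this is the Hilbert-Schmidt inner product; taking values in [R] keeps all
    later estimates in an ordered field. *)
Definition retr n (A B : 'M[R[i]]_n) : R := complex.Re (\tr (A *m B)).

Lemma retrC n (A B : 'M[R[i]]_n) : retr A B = retr B A.
Proof. by rewrite /retr mxtrace_mulC. Qed.

Lemma retrDl n (A B C : 'M[R[i]]_n) : retr (A + B) C = retr A C + retr B C.
Proof. by rewrite /retr mulmxDl linearD raddfD. Qed.

Lemma retrBl n (A B C : 'M[R[i]]_n) : retr (A - B) C = retr A C - retr B C.
Proof. by rewrite /retr mulmxBl linearB raddfB. Qed.

Lemma retrZl n x (A B : 'M[R[i]]_n) : retr (x%:C *: A) B = x * retr A B.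
Proof.
rewrite /retr -scalemxAl linearZ /=.
by case: (\tr _) => a b /=; rewrite mul0r subr0.
Qed.

Lemma retr_suml n (I : finType) (F : I -> 'M[R[i]]_n) A :
  retr (\sum_i F i) A = \sum_i retr (F i) A.
Proof.
elim/big_rec2: _ => [|i x B _ <-]; last exact: retrDl.
by rewrite /retr mul0mx linear0.
Qed.

Lemma retrDr n (A B C : 'M[R[i]]_n) : retr A (B + C) = retr A B + retr A C.
Proof. by rewrite !(retrC A) retrDl. Qed.

Lemma retrBr n (A B C : 'M[R[i]]_n) : retr A (B - C) = retr A B - retr A C.
Proof. by rewrite !(retrC A) retrBl. Qed.

Lemma retrZr n x (A B : 'M[R[i]]_n) : retr A (x%:C *: B) = x * retr A B.
Proof. by rewrite !(retrC A) retrZl. Qed.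

Lemma retr_sumr n (I : finType) (F : I -> 'M[R[i]]_n) A :
  retr A (\sum_i F i) = \sum_i retr A (F i).
Proof. by rewrite retrC retr_suml; apply: eq_bigr => i _; rewrite retrC. Qed.

Lemma retr1l n (A : 'M[R[i]]_n) : retr 1%:M A = complex.Re (\tr A).
Proof. by rewrite /retr mul1mx. Qed.

Lemma retr_herm n (A B : 'M[R[i]]_n) :
  A \is hermsymmx -> B \is hermsymmx -> \tr (A *m B) = (retr A B)%:C.
Proof.
move=> /hermP hA /hermP hB; rewrite /retr.
have : Num.conj (\tr (A *m B)) = \tr (A *m B).
  rewrite -trace_map_mx -mxtrace_tr map_trmx trmx_mul map_mxM hA hB.
  by rewrite mxtrace_mulC.
case: (\tr _) => a b /eqP; rewrite eq_complex /= eqxx /= => /eqP h.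
by congr (_ +i* _); lra.
Qed.

Lemma retr_ge0 n (A : 'M[R[i]]_n) : A \is hermsymmx -> 0 <= retr A A.
Proof.
move=> hA; rewrite -lecR -retr_herm //; move/hermP: hA => hA.
rewrite -{1}hA; apply: sumr_ge0 => i _; rewrite mxE; apply: sumr_ge0 => j _.
by rewrite !mxE mulrC mul_conjC_ge0.
Qed.

Lemma retr_CauchySchwarz n (A B : 'M[R[i]]_n) :
  A \is hermsymmx -> B \is hermsymmx ->
  retr A B ^+ 2 <= retr A A * retr B B.
Proof.
move=> hA hB; set m := retr A B.
have key x y : 0 <= x ^+ 2 * retr A A - 2 * x * y * m + y ^+ 2 * retr B B.
  have := retr_ge0 (hermB (hermZ x hA) (hermZ y hB)).
  rewrite !(retrBl, retrBr, retrZl, retrZr) (retrC B A) -/m; congr (_ <= _).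
  by ring.
have b0 := retr_ge0 hB; have a0 := retr_ge0 hA.
have [b1|b1] := eqVneq (retr B B) 0; last first.
  have bp : 0 < retr B B by rewrite lt_def b1.
  rewrite -subr_ge0 -(pmulr_rge0 _ bp).
  (* At this point the quadratic form is [retr B B] times the Cauchy-Schwarz defect. *)
  by have := key (retr B B) m; congr (_ <= _); ring.
(* When [retr B B] vanishes the form is linear in [y]; this [y] makes its value [- m ^+ 2], which
   forces [m] to be 0. *)
have := key m ((retr A A + 1) / 2); rewrite b1 mulr0 addr0.
rewrite mulr0; have -> : m ^+ 2 * retr A A - 2 * m * ((retr A A + 1) / 2) * m
  = - m ^+ 2 by field.
by rewrite oppr_ge0.
Qed.

Lemma retr_tens m n (A C : 'M[R[i]]_m) (B D : 'M[R[i]]_n) :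
  A \is hermsymmx -> B \is hermsymmx -> C \is hermsymmx -> D \is hermsymmx ->
  retr (A *t B) (C *t D) = retr A C * retr B D.
Proof.
move=> hA hB hC hD; rewrite /retr tensmx_mul mxtrace_tens.
by rewrite (retr_herm hA hC) (retr_herm hB hD) -rmorphM.
Qed.

(** After diagonalisation the two sides are the sum of the squared eigenvalues and the square of
    their sum; the eigenvalues are nonnegative. *)
Lemma psd_retr n (A : 'M[R[i]]_n) :
  is_psd A -> retr A A <= (complex.Re (\tr A)) ^+ 2.
Proof.
move=> [hA pA]; have /hermitian_normalmx/orthomx_spectralP hS := hA.
set P := spectralmx A in hS; set D := spectral_diag A in hS.
have uP : P \is unitarymx := spectral_unitarymx A.
have PV : P *m invmx P = 1%:M by rewrite mulmxV // unitarymx_unit.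
have DE : diag_mx D = P *m A *m P^t*.
  by rewrite {1}hS -(invmx_unitary uP) !mulmxA PV mul1mx -mulmxA PV mulmx1.
have D0 i : 0 <= D 0 i.
  (* An eigenvalue is the quadratic form of [A] at its eigenvector, the adjoint of a row of [P]. *)
  have -> : D 0 i = (((row i P)^t*)^t* *m A *m (row i P)^t*) 0 0.
    rewrite trmxCK -row_mul.
    have -> : D 0 i = diag_mx D i i by rewrite mxE eqxx mulr1n.
    rewrite DE !mxE; apply: eq_bigr => j _; rewrite !mxE; congr (_ * _).
  exact: pA.
have trA : \tr A = \sum_i D 0 i.
  by rewrite {1}hS -mulmxA mxtrace_mulC -mulmxA PV mulmx1 mxtrace_diag.
have trAA : \tr (A *m A) = \sum_i D 0 i ^+ 2.
  rewrite {1 2}hS -!mulmxA (mulmxA P) PV mul1mx mxtrace_mulC -!mulmxA.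
  rewrite PV mulmx1 mulmx_diag mxtrace_diag.
  by apply: eq_bigr => i _; rewrite mxE.
have tr0 : 0 <= \tr A by rewrite trA sumr_ge0.
have trE : \tr A = (complex.Re (\tr A))%:C by rewrite RRe_real // ger0_real.
rewrite -lecR -retr_herm // trAA rmorphXn /= -trE trA.
rewrite expr2 mulr_suml; apply: ler_sum => i _.
by rewrite expr2 ler_wpM2l // (bigD1 i) //= lerDl sumr_ge0.
Qed.
Lemma frobenius_herm n (A : 'M[R[i]]_n) :
  A \is hermsymmx -> frobenius A = Num.sqrt (retr A A).
Proof. by move=> /hermP hA; rewrite /frobenius hA. Qed.

Lemma mxvec_dot n (A B : 'M[R[i]]_n) :
  \sum_p mxvec A 0 p * mxvec B^T 0 p = \tr (A *m B).
Proof.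
rewrite /mxtrace; under [RHS]eq_bigr => k _ do rewrite mxE.
rewrite pair_big /= (reindex _ (curry_mxvec_bij _ _)) /=.
by apply: eq_bigr => -[k l] _ /=; rewrite !mxvecE mxE.
Qed.

(** Serves for [1 + (d ^ 2 - 1)] and [d * d], which are equal but not convertible. *)
Lemma mulmx1C_eq m n (A : 'M[R[i]]_(m, n)) (B : 'M[R[i]]_(n, m)) :
  m = n -> A *m B = 1%:M -> B *m A = 1%:M.
Proof. by move=> e; subst n; exact: mulmx1C. Qed.

End TraceForm.

(** * Completeness and Casimir relations of the generators *)

Section Generators.
Variables (R : realType) (d : nat).
Hypothesis d_gt0 : (0 < d)%N.
Variable g : 'I_(d ^ 2 - 1)%N -> 'M[R[i]]_d.
Hypothesis hg : su_generators g.

Let g_herm k : g k \is hermsymmx. Proof. by case: hg. Qed.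
Let g_tr0 k : \tr (g k) = 0. Proof. by case: hg. Qed.
Let g_orth k l : \tr (g k *m g l) = 2 * (k == l)%:R. Proof. by case: hg. Qed.

(* The matrices [1 / sqrt d] and [g k / sqrt 2] form an orthonormal family of
   [d ^ 2] matrices: the matrix that lists their entries is square with
   orthonormal rows, hence has orthonormal columns. *)
Lemma su_completeness (a b c e : 'I_d) :
  \sum_k g k a b * g k c e =
  2 * ((a == e)%:R * (b == c)%:R - d%:R^-1 * (a == b)%:R * (c == e)%:R).
Proof.
have dn0 : d%:R != 0 :> R[i] by rewrite pnatr_eq0 -lt0n.
pose F (i : 'I_(1 + (d ^ 2 - 1))) := if split i is inr k then g k else 1%:M.
(* [G] is the dual family of [F]: it carries the full inverse squared norms, so no square roots
   appear. *)
pose G (i : 'I_(1 + (d ^ 2 - 1))) :=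
  if split i is inr k then 2^-1 *: g k else d%:R^-1 *: 1%:M.
pose A := \matrix_(i < (1 + (d ^ 2 - 1))%N, p < (d * d)%N) mxvec (F i) 0 p.
pose B := \matrix_(p < (d * d)%N, i < (1 + (d ^ 2 - 1))%N) mxvec (G i)^T 0 p.
have AB : A *m B = 1%:M.
  apply/matrixP => i j; rewrite [LHS]mxE.
  under eq_bigr => p _ do rewrite [A _ _]mxE [B _ _]mxE.
  rewrite mxvec_dot /F /G -(splitK i) -(splitK j) !unsplitK mxE.
  rewrite (inj_eq (can_inj unsplitK)).
  case: (split i) => k; case: (split j) => l; rewrite -scalemxAr linearZ /=.
  - by rewrite mulmx1 mxtrace1 mulVf // !ord1 eqxx.
  - by rewrite mul1mx g_tr0 mulr0.
  - by rewrite mulmx1 g_tr0 mulr0.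
  - by rewrite g_orth mulrA mulVf ?pnatr_eq0 // mul1r.
(* [B] lists transposes, hence the index [(b, a)] for the entry [(a, b)]. *)
have /matrixP/(_ (mxvec_index b a) (mxvec_index c e)) : B *m A = 1%:M.
  apply: mulmx1C_eq AB; rewrite subnKC ?expn_gt0 ?d_gt0 // mulnn.
rewrite !mxE; under eq_bigr => p _ do rewrite [A _ _]mxE [B _ _]mxE.
rewrite big_split_ord big_ord1 /= /F /G (unsplitK (inl _)).
under eq_bigr => k _ do rewrite (unsplitK (inr k)).
rewrite !mxvecE.
have -> : (mxvec_index b a == mxvec_index c e)%:R =
    (b == c)%:R * (a == e)%:R :> R[i].
  rewrite -natrM mulnb -(eq_sym c) -(eq_sym e).
  have <- : mxvec (delta_mx b a) 0 (mxvec_index c e) =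
      ((c == b) && (e == a))%:R :> R[i].
    by rewrite mxvecE mxE.
  by rewrite mxvec_delta mxE eqxx eq_sym.
rewrite !mxE => h.
have -> : \sum_k g k a b * g k c e =
    2 * \sum_(k < d ^ 2 - 1) mxvec (2^-1 *: g k)^T 0 (mxvec_index b a) *
     mxvec (g k) 0 (mxvec_index c e).
  rewrite mulr_sumr; apply: eq_bigr => k _; rewrite !mxvecE !mxE.
  by rewrite !mulrA mulfV ?pnatr_eq0 // mul1r.
move/(congr1 (fun x => x - d%:R^-1 * (a == b)%:R * (c == e)%:R)): h.
rewrite [X in X = _]addrAC subrr add0r => ->.
by rewrite mulrC; ring.
Qed.

(** Contract the completeness relation over its two inner indices: its first term gives [d], its
    second the inverse of [d]. *)
Lemma su_casimir :
  \sum_k g k *m g k = (2 * (d%:R - d%:R^-1))%:C *: 1%:M.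
Proof.
have dn0 : d%:R != 0 :> R[i] by rewrite pnatr_eq0 -lt0n.
apply/matrixP => a e; rewrite summxE.
under eq_bigr => k _ do rewrite mxE.
rewrite exchange_big /=; under eq_bigr => b _ do rewrite su_completeness.
rewrite -mulr_sumr sumrB /=.
under eq_bigr => b _ do rewrite eqxx mulr1.
rewrite sumr_const card_ord (bigD1 a) //= big1 ?addr0 => [|b /negbTE ba];
  last first.
  by rewrite eq_sym ba mulr0 mul0r.
rewrite eqxx !mxE rmorphM rmorphB fmorphV !rmorph_nat -[_ *+ d]mulr_natr.
by rewrite /=; ring.
Qed.

End Generators.

(** * Traces and products of collective operators *)

Section Collective.
Variables (R : realType) (d : nat).
Implicit Types A B : 'M[R[i]]_d.

Lemma herm_collective A : A \is hermsymmx -> collective A \is hermsymmx.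
Proof. by move=> hA; apply: hermD; apply: herm_tens => //; exact: herm1. Qed.

Lemma mxtrace_collective A : \tr (collective A) = 2 * d%:R * \tr A.
Proof. by rewrite linearD /= !mxtrace_tens mxtrace1; ring. Qed.

Lemma retr_collective_tens A B C :
  A \is hermsymmx -> B \is hermsymmx -> C \is hermsymmx ->
  retr (collective A) (B *t C) =
  retr A B * complex.Re (\tr C) + complex.Re (\tr B) * retr A C.
Proof.
move=> hA hB hC; rewrite retrDl !retr_tens ?herm1 //.
by rewrite !retr1l.
Qed.

Lemma retr_collective A B :
  A \is hermsymmx -> B \is hermsymmx ->
  retr (collective A) (collective B) =
  2 * d%:R * retr A B + 2 * complex.Re (\tr A) * complex.Re (\tr B).
Proof.
move=> hA hB; rewrite [collective B]/collective retrDr.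
rewrite !retr_collective_tens ?herm1 // !(retrC _ 1%:M) !retr1l mxtrace1.
by rewrite raddfMn /=; ring.
Qed.

Lemma collective_mul A :
  collective A *m collective A =
  (A *m A) *t 1%:M + 1%:M *t (A *m A) + 2%:C *: (A *t A).
Proof.
rewrite mulmxDl !mulmxDr !tensmx_mul !mul1mx !mulmx1.
by apply/matrixP => i j; rewrite !mxE; ring.
Qed.

End Collective.

(** * Purity of states *)

Section State.
Variables (R : realType) (n : nat) (rho : 'M[R[i]]_n).
Hypothesis hrho : is_state rho.

Lemma state_herm : rho \is hermsymmx. Proof. by case: hrho => -[]. Qed.

Lemma state_trace : complex.Re (\tr rho) = 1.
Proof. by case: hrho => _ ->. Qed.

Lemma state_purity : retr rho rho <= 1.
Proof.
by case: hrho => /psd_retr h t; move: h; rewrite t /= expr1n.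
Qed.

(** Removing the maximally mixed state keeps the pairing with traceless matrices and sharpens the
    purity bound from 1 to [1 - n%:R^-1]. *)
Definition traceless_part := rho - (n%:R^-1)%:C *: 1%:M.

Lemma herm_traceless_part : traceless_part \is hermsymmx.
Proof. by apply: hermB; [exact: state_herm|apply: hermZ; exact: herm1]. Qed.

Lemma retr_traceless_part (A : 'M_n) :
  \tr A = 0 -> retr A traceless_part = retr A rho.
Proof.
by move=> A0; rewrite retrBr retrZr (retrC A 1%:M) retr1l A0 mulr0 subr0.
Qed.

Lemma traceless_part_purity :
  (0 < n)%N -> retr traceless_part traceless_part <= 1 - n%:R^-1.
Proof.
move=> n0; have n1 : n%:R != 0 :> R by rewrite pnatr_eq0 -lt0n.
rewrite /traceless_part !(retrBl, retrBr, retrZl, retrZr) (retrC rho 1%:M).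
rewrite !retr1l state_trace mxtrace1 raddfMn /=.
have := state_purity; set x := retr _ _ => h.
have -> : n%:R^-1 * (n%:R^-1 * n%:R) = n%:R^-1 :> R by field.
lra.
Qed.

End State.

Lemma herm_sep (R : realType) (d : nat) (sigma : 'M[R[i]]_(d * d)) :
  Sep sigma -> sigma \is hermsymmx.
Proof.
move=> [m [p [a [b [_ _ ha hb ->]]]]]; apply: herm_sum => k; apply: hermZ.
by apply: herm_tens; exact: state_herm.
Qed.

(** * The witness for arbitrary real shifts [c], and its positivity on product states *)

Section Witness.
Variables (R : realType) (d : nat).
Hypothesis d_gt0 : (0 < d)%N.
Variable g : 'I_(d ^ 2 - 1)%N -> 'M[R[i]]_d.
Hypothesis hg : su_generators g.

Let g_herm k : g k \is hermsymmx. Proof. by case: hg. Qed.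
Let g_tr0 k : \tr (g k) = 0. Proof. by case: hg. Qed.
Let g_orth k l : retr (g k) (g l) = 2 * (k == l)%:R.
Proof.
apply: complexI; rewrite -retr_herm //; case: hg => _ _ ->.
by rewrite rmorphM !rmorph_nat.
Qed.

Let dim_su : (d ^ 2 - 1)%:R = d%:R ^+ 2 - 1 :> R.
Proof. by rewrite natrB ?natrX // expn_gt0 d_gt0. Qed.

Lemma su_bessel (a : 'M[R[i]]_d) :
  is_state a -> \sum_k retr (g k) a ^+ 2 <= 2 - 2 * d%:R^-1.
Proof.
move=> ha; have := traceless_part_purity ha d_gt0.
have := herm_traceless_part ha.
have : forall k, retr (g k) (traceless_part a) = retr (g k) a.
  by move=> k; exact: retr_traceless_part.
move: (traceless_part a) => a' gE ha' pur.
pose P := \sum_k (retr (g k) a)%:C *: g k.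
have hP : P \is hermsymmx by apply: herm_sum => k; exact: hermZ.
have PP : retr P P = 2 * \sum_k retr (g k) a ^+ 2.
  rewrite retr_suml mulr_sumr; apply: eq_bigr => k _.
  rewrite retrZl retr_sumr (bigD1 k) //= big1 => [|l /negbTE lk].
    by rewrite retrZr g_orth eqxx /=; ring.
  by rewrite retrZr g_orth eq_sym lk !mulr0.
have Pa : retr P a' = \sum_k retr (g k) a ^+ 2.
  by rewrite retr_suml; apply: eq_bigr => k _; rewrite retrZl gE.
(* Each generator has squared norm 2, so [P / 2] is the orthogonal projection of [a'] onto their
   span. *)
have := retr_ge0 (hermB ha' (hermZ 2^-1 hP)).
rewrite !(retrBl, retrBr, retrZl, retrZr) (retrC a' P) PP Pa.
move: pur; set x := retr a' a'; set s := \sum_k _; set y := d%:R^-1.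
lra.
Qed.

Definition sum_tens_gen := \sum_k g k *t g k.

Lemma herm_sum_tens_gen : sum_tens_gen \is hermsymmx.
Proof. by apply: herm_sum => k; exact: herm_tens. Qed.

Lemma retr_sum_tens_gen : retr sum_tens_gen sum_tens_gen = 4 * (d%:R ^+ 2 - 1).
Proof.
have -> : d%:R ^+ 2 - 1 = \sum_(k < (d ^ 2 - 1)%N) 1 :> R.
  by rewrite sumr_const card_ord -dim_su.
rewrite retr_suml mulr_sumr; apply: eq_bigr => k _.
rewrite retr_sumr (bigD1 k) //= big1 => [|l /negbTE lk].
  by rewrite retr_tens // g_orth eqxx /=; ring.
by rewrite retr_tens // g_orth eq_sym lk mulr0 mul0r.
Qed.

(** Each term of [collective] has the identity on one factor, where it meets a traceless
    generator. *)
Lemma retr_sum_tens_gen_collective k : retr sum_tens_gen (collective (g k)) = 0.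
Proof.
rewrite retr_suml big1 // => l _.
by rewrite retrC retr_collective_tens // g_tr0 mulr0 mul0r addr0.
Qed.

Variable c : 'I_(d ^ 2 - 1)%N -> R.

Definition mean_coupling := \sum_k (c k)%:C *: collective (g k).

Lemma herm_mean_coupling : mean_coupling \is hermsymmx.
Proof. by apply: herm_sum => k; apply: hermZ; exact: herm_collective. Qed.

Lemma mxtrace_mean_coupling : \tr mean_coupling = 0.
Proof.
rewrite linear_sum big1 // => k _.
by rewrite linearZ /= mxtrace_collective g_tr0 !mulr0.
Qed.

Lemma retr_mean_coupling :
  retr mean_coupling mean_coupling = 4 * d%:R * \sum_k c k ^+ 2.
Proof.
rewrite retr_suml mulr_sumr; apply: eq_bigr => k _.
rewrite retrZl retr_sumr (bigD1 k) //= big1 => [|l /negbTE lk].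
  by rewrite retrZr retr_collective // g_orth g_tr0 eqxx /=; ring.
by rewrite retrZr retr_collective // g_orth g_tr0 eq_sym lk /=; ring.
Qed.

Definition witness := 2%:C *: sum_tens_gen - 2%:C *: mean_coupling.

Lemma herm_witness : witness \is hermsymmx.
Proof.
by apply: hermB; apply: hermZ;
  [exact: herm_sum_tens_gen|exact: herm_mean_coupling].
Qed.

Lemma retr_witness :
  retr witness witness = 16 * (d%:R ^+ 2 - 1) + 16 * d%:R * \sum_k c k ^+ 2.
Proof.
have SH : retr sum_tens_gen mean_coupling = 0.
  rewrite retr_sumr big1 // => k _.
  by rewrite retrZr retr_sum_tens_gen_collective mulr0.
rewrite !(retrBl, retrBr, retrZl, retrZr) (retrC mean_coupling) SH.
by rewrite retr_mean_coupling retr_sum_tens_gen; ring.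
Qed.

(** The coefficient of the identity: the Casimir value from each of the two factors, the squared
    shifts, and the constant subtracted in [W2]. *)
Definition offset : R :=
  4 * (d%:R - d%:R^-1) + \sum_k c k ^+ 2 - (4 * d%:R - 4).

Lemma sum_sqr_collective :
  \sum_k (collective (g k) - (c k)%:C%:M) ^+ 2 - (4 * d%:R - 4)%:M
  = witness + offset%:C *: 1%:M.
Proof.
have sq k : (collective (g k) - (c k)%:C%:M) ^+ 2 =
    (g k *m g k) *t 1%:M + 1%:M *t (g k *m g k) + 2%:C *: (g k *t g k)
    - 2%:C *: ((c k)%:C *: collective (g k)) + (c k ^+ 2)%:C *: 1%:M.
  rewrite expr2 -[_ * _]/(_ *m _) mulmxBl !mulmxBr collective_mul.
  rewrite mul_mx_scalar !mul_scalar_mx.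
  apply/matrixP => i j; rewrite !mxE rmorphXn /= mulr_natr; ring.
under eq_bigr => k _ do rewrite sq.
rewrite !big_split /= sumrN -!scaler_sumr -tensmx_suml -tensmx_sumr.
rewrite su_casimir // -scaler_suml -/sum_tens_gen -/mean_coupling.
rewrite -rmorph_sum /=.
rewrite /witness /offset.
rewrite tensmxZl tensmxZr tensmx11.
have -> : (4 * d%:R - 4)%:M = (4 * d%:R - 4)%:C *: 1%:M :> 'M[R[i]]_(d * d).
  rewrite scale_scalar_mx mulr1; congr (_%:M).
  by rewrite rmorphB rmorphM !rmorph_nat.
move: sum_tens_gen mean_coupling (1%:M : 'M_(d * d)) => S H E.
apply/matrixP => i j; rewrite !mxE.
rewrite !(rmorphM, rmorphB, rmorphD, rmorph_nat) /=.
by ring.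
Qed.

(** In a product state the mean of [collective (g k)] is the sum of the local means. Completing
    squares leaves [4 - 4 * d%:R^-1] minus two Bessel sums, and this constant is exactly twice the
    bound of [su_bessel]. *)
Lemma witness_product (a b : 'M[R[i]]_d) :
  is_state a -> is_state b -> 0 <= retr witness (a *t b) + offset.
Proof.
move=> sa sb; have ha := state_herm sa; have hb := state_herm sb.
have -> : retr witness (a *t b) + offset =
    \sum_k (c k - retr (g k) a - retr (g k) b) ^+ 2 + (4 - 4 * d%:R^-1)
    - \sum_k retr (g k) a ^+ 2 - \sum_k retr (g k) b ^+ 2.
  rewrite retrBl !retrZl !retr_suml /offset.
  have -> : \sum_k (c k - retr (g k) a - retr (g k) b) ^+ 2 =
    2 * \sum_k retr (g k *t g k) (a *t b)
    - 2 * \sum_k retr ((c k)%:C *: collective (g k)) (a *t b)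
    + \sum_k c k ^+ 2 + \sum_k retr (g k) a ^+ 2 + \sum_k retr (g k) b ^+ 2.
    rewrite !mulr_sumr -sumrB -!big_split /=; apply: eq_bigr => k _.
    rewrite retrZl retr_collective_tens // retr_tens // !state_trace //.
    by ring.
  ring.
have := su_bessel sa; have := su_bessel sb.
have : 0 <= \sum_k (c k - retr (g k) a - retr (g k) b) ^+ 2.
  by apply: sumr_ge0 => k _; exact: sqr_ge0.
lra.
Qed.

End Witness.

(** * Shifts equal to the means in [rho], and the distance bound *)

Section Bound.
Variables (R : realType) (d : nat).
Hypothesis hd : (2 <= d)%N.
Variable g : 'I_(d ^ 2 - 1)%N -> 'M[R[i]]_d.
Hypothesis hg : su_generators g.
Variable rho : 'M[R[i]]_(d * d).
Hypothesis hrho : is_state rho.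

Let c k := retr (collective (g k)) rho.
Let W := witness g c.
Let d_gt0 : (0 < d)%N. Proof. exact: leq_trans hd. Qed.
Let rho_herm := state_herm hrho.

(** With [L] the sum, [H] pairs with the traceless part of [rho] to [L] and has squared norm
    [4 * d%:R * L], so Cauchy-Schwarz can be divided by [L]. *)
Lemma sum_sqr_expectation : \sum_k c k ^+ 2 <= 4 * d%:R - 4 * d%:R^-1.
Proof.
set L := \sum_k _; set H := mean_coupling g c.
have hH : H \is hermsymmx by exact: herm_mean_coupling.
have HL : retr H (traceless_part rho) = L.
  rewrite retr_traceless_part ?mxtrace_mean_coupling // retr_suml.
  by apply: eq_bigr => k _; rewrite retrZl -expr2.
have := retr_CauchySchwarz hH (herm_traceless_part hrho).
rewrite HL retr_mean_coupling // -/L.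
have := traceless_part_purity hrho; rewrite muln_gt0 d_gt0 => /(_ isT).
set x := retr _ _ => hx cs.
have dR : 2 <= d%:R :> R by rewrite ler_nat.
have L0 : 0 <= L by apply: sumr_ge0 => k _; exact: sqr_ge0.
(* The division by [L] excludes 0, where the bound holds because its right side is nonnegative. *)
have [->|Ln0] := eqVneq L 0.
  have : d%:R^-1 <= 1 :> R by rewrite invf_le1; lra.
  by lra.
have Lp : 0 < L by rewrite lt_def Ln0.
have h1 : L <= 4 * d%:R * x.
  by rewrite -(ler_pM2r Lp); move: cs; congr (_ <= _); ring.
apply: (le_trans h1).
have -> : 4 * d%:R - 4 * d%:R^-1 = 4 * d%:R * (1 - (d * d)%:R^-1) :> R.
  by rewrite natrM; field; lra.
by rewrite ler_wpM2l // mulr_ge0 // ler0n.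
Qed.

Lemma witness_norm_le : retr W W <= 144 * d%:R ^+ 2 - 224 * d%:R + 112.
Proof.
rewrite retr_witness //.
have dR : 2 <= d%:R :> R by rewrite ler_nat.
have h : d%:R * \sum_k c k ^+ 2 <= 4 * d%:R ^+ 2 - 4.
  have -> : 4 * d%:R ^+ 2 - 4 = d%:R * (4 * d%:R - 4 * d%:R^-1) :> R.
    by field; lra.
  by rewrite ler_wpM2l ?ler0n //; exact: sum_sqr_expectation.
(* The squared norm is at most [80 * (d%:R ^+ 2 - 1)]; the claimed bound exceeds this by 32 times
   the product below. *)
have : 0 <= (2 * d%:R - 3) * (d%:R - 2) :> R by apply: mulr_ge0; lra.
by rewrite -mulrA; nra.
Qed.

Lemma W2E : W2 g rho = W + (offset c)%:C *: 1%:M.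
Proof.
rewrite -sum_sqr_collective // /W2; congr (_ - _); apply: eq_bigr => k _.
by rewrite /expectation retr_herm //; apply: herm_collective; case: hg.
Qed.

Lemma expectation_W2 : expectation rho (W2 g rho) = (retr W rho + offset c)%:C.
Proof.
rewrite /expectation W2E mulmxDl linearD /= retr_herm ?herm_witness //.
rewrite -scalemxAl linearZ /= mul1mx; case: hrho => _ ->.
by rewrite mulr1 -rmorphD.
Qed.

Lemma witness_sep sigma : @Sep R d sigma -> 0 <= retr W sigma + offset c.
Proof.
move=> [m [p [a [b [p0 p1 ha hb ->]]]]].
(* The weights sum to 1, so [offset c] can be spread over the product terms. *)
rewrite retr_sumr -[offset c]mul1r -p1 mulr_suml -big_split /=.
apply: sumr_ge0 => k _; rewrite retrZr -mulrDr mulr_ge0 //.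
exact: witness_product.
Qed.

Lemma sep_dist_ge sigma : @Sep R d sigma ->
  - (retr W rho + offset c) <=
  Num.sqrt (144 * d%:R ^+ 2 - 224 * d%:R + 112) * frobenius (rho - sigma).
Proof.
move=> hs; have hD := hermB rho_herm (herm_sep hs).
have hW : W \is hermsymmx by exact: herm_witness.
have /(le_trans _) : Num.sqrt (retr W W) * frobenius (rho - sigma) <=
  Num.sqrt (144 * d%:R ^+ 2 - 224 * d%:R + 112) * frobenius (rho - sigma).
  rewrite ler_wpM2r ?sqrtr_ge0 // ler_sqrt ?witness_norm_le //.
  by rewrite (le_trans (retr_ge0 hW)) ?witness_norm_le.
apply; rewrite frobenius_herm // -sqrtrM ?retr_ge0 //.
have : `|retr W (rho - sigma)| <=
    Num.sqrt (retr W W * retr (rho - sigma) (rho - sigma)).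
  by rewrite -sqrtr_sqr ler_sqrt ?retr_CauchySchwarz // mulr_ge0 // retr_ge0.
(* Adding the nonnegative value at [sigma] cancels [offset c], leaving the pairing of [W] with
   [sigma - rho]. *)
apply: le_trans; rewrite -normrN (le_trans _ (ler_norm _)) //.
by have := witness_sep hs; rewrite retrBr; lra.
Qed.

End Bound.

Theorem mainTheorem5 (R : realType) (d : nat) (hd : (2 <= d)%N)
    (g : 'I_(d ^ 2 - 1)%N -> 'M[R[i]]_d) (hg : su_generators g)
    (rho : 'M[R[i]]_(d * d)) (hrho : is_state rho) :
  (Dsep rho)%:C >=
    - (expectation rho (W2 g rho)
       / (Num.sqrt (144 * d%:R ^+ 2 - 224 * d%:R + 112))%:C).
Proof.
(* The mean of [W2] is real, so the complex inequality descends to [R]. *)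
rewrite expectation_W2 // -fmorphV -rmorphM -rmorphN lecR /=.
have dR : 2 <= d%:R :> R by rewrite ler_nat.
have N0 : 0 < Num.sqrt (144 * d%:R ^+ 2 - 224 * d%:R + 112) :> R.
  by rewrite sqrtr_gt0; nra.
(* A lower bound passes to [inf] only for a nonempty set; on the empty set [inf] is a default
   value. *)
have [ne _] := has_inf_sep_dist rho (ltnW hd).
apply: lb_le_inf => // _ [sigma hs <-].
by rewrite -mulNr ler_pdivrMr // mulrC; exact: sep_dist_ge.
Qed.
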